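(* Let $\gamma_1,\gamma_2>0$, let $\theta\in\mathbb{R}$ and $\varepsilon\in\mathcal{S}_G^2$, and let $q=\cos\theta+\varepsilon\sin\theta\in\mathcal{S}_G^3\subset\mathbb{H}(\gamma_1,\gamma_2)$. Then $q^n=\cos n\theta+\varepsilon\sin n\theta$ for every integer $n$.
   Context: For $\gamma_1,\gamma_2>0$, the generalized quaternion algebra $\mathbb{H}(\gamma_1,\gamma_2)$ is the associative unital real algebra with basis $\{1,e_1,e_2,e_3\}$ and multiplication $e_1^2=-\gamma_1$, $e_2^2=-\gamma_2$, $e_3^2=-\gamma_1\gamma_2$, $e_1e_2=-e_2e_1=e_3$, $e_2e_3=-e_3e_2=\gamma_2e_1$, $e_3e_1=-e_1e_3=\gamma_1e_2$. For $q=q_0+q_1e_1+q_2e_2+q_3e_3$ put $|q|=\sqrt{q_0^2+\gamma_1q_1^2+\gamma_2q_2^2+\gamma_1\gamma_2q_3^2}$, $\mathcal{S}_G^3=\{q\in\mathbb{H}(\gamma_1,\gamma_2):|q|=1\}$ and $\mathcal{S}_G^2=\{q\in\mathbb{H}(\gamma_1,\gamma_2):q_0=0,\ |q|=1\}$. A $q\in\mathcal{S}_G^3$ with nonzero vector part is expressed as $q=\cos\theta+\varepsilon\sin\theta$ with $\cos\theta=q_0$ and $\varepsilon=\frac{q_1e_1+q_2e_2+q_3e_3}{\sqrt{\gamma_1q_1^2+\gamma_2q_2^2+\gamma_1\gamma_2q_3^2}}\in\mathcal{S}_G^2$. *)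

(* Defs.v *)
From HB Require Import structures.
From mathcomp Require Import all_boot all_order all_algebra.
From mathcomp Require Import boolp classical_sets reals trigo.
From mathcomp Require Import ring.

Set Implicit Arguments.
Unset Strict Implicit.
Unset Printing Implicit Defensive.

Import Order.TTheory GRing.Theory Num.Theory.

Local Open Scope ring_scope.

(* [Quat g1 g2 a b c d] is a + b e1 + c e2 + d e3.  The parameters are
   arbitrary reals here; the algebra is defined without g1, g2 > 0. *)
Record quat (R : realType) (g1 g2 : R) := Quat
  { qre : R; qi : R; qj : R; qk : R }.

Arguments Quat {R} g1 g2 _ _ _ _.

Section QuatAlgebra.
Variables (R : realType) (g1 g2 : R).
Local Notation H := (quat g1 g2).
Local Notation Q := (Quat g1 g2).
Implicit Types p q r : H.

Definition quat_to_prod q := (qre q, qi q, qj q, qk q).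
Definition prod_to_quat (t : R * R * R * R) : H :=
  Q t.1.1.1 t.1.1.2 t.1.2 t.2.

Lemma quat_to_prodK : cancel quat_to_prod prod_to_quat.
Proof. by case. Qed.

HB.instance Definition _ := Choice.copy H (can_type quat_to_prodK).

Lemma quatP p q : qre p = qre q -> qi p = qi q -> qj p = qj q ->
  qk p = qk q -> p = q.
Proof. by case: p => a b c d; case: q => a' b' c' d' /= -> -> -> ->. Qed.

Definition quat0 : H := Q 0 0 0 0.
Definition quat_opp q : H := Q (- qre q) (- qi q) (- qj q) (- qk q).
Definition quat_add p q : H :=
  Q (qre p + qre q) (qi p + qi q) (qj p + qj q) (qk p + qk q).

Lemma quat_addA : associative quat_add.
Proof. by move=> p q r; apply: quatP; rewrite /= addrA. Qed.
Lemma quat_addC : commutative quat_add.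
Proof. by move=> p q; apply: quatP; rewrite /= addrC. Qed.
Lemma quat_add0 : left_id quat0 quat_add.
Proof. by move=> p; apply: quatP; rewrite /= add0r. Qed.
Lemma quat_addN : left_inverse quat0 quat_opp quat_add.
Proof. by move=> p; apply: quatP; rewrite /= addNr. Qed.

HB.instance Definition _ :=
  GRing.isZmodule.Build H quat_addA quat_addC quat_add0 quat_addN.

Definition quat1 : H := Q 1 0 0 0.

(* Bilinear extension of the multiplication table of e1, e2, e3; the table
   itself is recovered in quat_e1e1 and the lemmas that follow it. *)
Definition quat_mul p q : H :=
  Q (qre p * qre q - g1 * (qi p * qi q) - g2 * (qj p * qj q)
       - g1 * g2 * (qk p * qk q))
    (qre p * qi q + qi p * qre q + g2 * (qj p * qk q - qk p * qj q))
    (qre p * qj q + qj p * qre q + g1 * (qk p * qi q - qi p * qk q))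
    (qre p * qk q + qk p * qre q + (qi p * qj q - qj p * qi q)).

Lemma quat_mulA : associative quat_mul.
Proof. by move=> p q r; apply: quatP => /=; ring. Qed.
Lemma quat_mul1l : left_id quat1 quat_mul.
Proof. by move=> p; apply: quatP => /=; ring. Qed.
Lemma quat_mul1r : right_id quat1 quat_mul.
Proof. by move=> p; apply: quatP => /=; ring. Qed.
Lemma quat_mulDl : left_distributive quat_mul +%R.
Proof. by move=> p q r; apply: quatP => /=; ring. Qed.
Lemma quat_mulDr : right_distributive quat_mul +%R.
Proof. by move=> p q r; apply: quatP => /=; ring. Qed.
Lemma quat1_neq0 : quat1 != 0.
Proof. by apply/eqP => -[] /eqP; rewrite oner_eq0. Qed.

HB.instance Definition _ := GRing.Zmodule_isNzRing.Build H
  quat_mulA quat_mul1l quat_mul1r quat_mulDl quat_mulDr quat1_neq0.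

Definition quat_scale (a : R) q : H :=
  Q (a * qre q) (a * qi q) (a * qj q) (a * qk q).

Lemma quat_scaleA a b q :
  quat_scale a (quat_scale b q) = quat_scale (a * b) q.
Proof. by apply: quatP; rewrite /= mulrA. Qed.
Lemma quat_scale1 : left_id 1 quat_scale.
Proof. by move=> q; apply: quatP; rewrite /= mul1r. Qed.
Lemma quat_scaleDr : right_distributive quat_scale +%R.
Proof. by move=> a p q; apply: quatP; rewrite /= mulrDr. Qed.
Lemma quat_scaleDl q : {morph quat_scale^~ q : a b / a + b}.
Proof. by move=> a b; apply: quatP; rewrite /= mulrDl. Qed.

HB.instance Definition _ := GRing.Zmodule_isLmodule.Build R H
  quat_scaleA quat_scale1 quat_scaleDr quat_scaleDl.

Lemma quat_scaleAl (a : R) p q : a *: (p * q) = (a *: p) * q.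
Proof. by apply: quatP => /=; ring. Qed.

HB.instance Definition _ := GRing.Lmodule_isLalgebra.Build R H quat_scaleAl.

Lemma quat_scaleAr (a : R) p q : a *: (p * q) = p * (a *: q).
Proof. by apply: quatP => /=; ring. Qed.

HB.instance Definition _ := GRing.Lalgebra_isAlgebra.Build R H quat_scaleAr.

Definition qnorm2 q : R :=
  qre q ^+ 2 + g1 * qi q ^+ 2 + g2 * qj q ^+ 2 + g1 * g2 * qk q ^+ 2.

Definition qconj q : H := Q (qre q) (- qi q) (- qj q) (- qk q).

Lemma qnorm2M p q : qnorm2 (p * q) = qnorm2 p * qnorm2 q.
Proof. by rewrite /qnorm2 /=; ring. Qed.

Lemma qnorm2_1 : qnorm2 1 = 1.
Proof. by rewrite /qnorm2 /=; ring. Qed.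

Lemma qmul_conj q : q * qconj q = (qnorm2 q)%:A.
Proof. by apply: quatP; rewrite /qnorm2 /=; ring. Qed.

Lemma qconj_mul q : qconj q * q = (qnorm2 q)%:A.
Proof. by apply: quatP; rewrite /qnorm2 /=; ring. Qed.

Definition quat_unit : pred H := fun q => qnorm2 q != 0.

(* Outside the units the library convention inv q = q applies. *)
Definition quat_inv q : H :=
  if qnorm2 q == 0 then q else (qnorm2 q)^-1 *: qconj q.

Lemma quat_mulVr : {in quat_unit, left_inverse 1 quat_inv *%R}.
Proof.
move=> q; rewrite unfold_in /quat_inv => /[dup] nq0 /negbTE ->.
by rewrite -scalerAl qconj_mul scalerA mulVf ?scale1r.
Qed.
Lemma quat_mulrV : {in quat_unit, right_inverse 1 quat_inv *%R}.
Proof.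
move=> q; rewrite unfold_in /quat_inv => /[dup] nq0 /negbTE ->.
by rewrite -scalerAr qmul_conj scalerA mulVf ?scale1r.
Qed.
Lemma quat_unitP p q : q * p = 1 /\ p * q = 1 -> quat_unit p.
Proof.
move=> [qp1 _]; rewrite /quat_unit; apply/eqP => p0.
by move/(congr1 qnorm2)/eqP: qp1;
  rewrite qnorm2M p0 mulr0 qnorm2_1 eq_sym oner_eq0.
Qed.
Lemma quat_inv_out : {in [predC quat_unit], quat_inv =1 id}.
Proof. by move=> q; rewrite inE unfold_in negbK /quat_inv => ->. Qed.

HB.instance Definition _ := GRing.NzRing_hasMulInverse.Build H
  quat_mulVr quat_mulrV quat_unitP quat_inv_out.

Definition qe1 : H := Q 0 1 0 0.
Definition qe2 : H := Q 0 0 1 0.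
Definition qe3 : H := Q 0 0 0 1.

Lemma quatE q : q = (qre q)%:A + qi q *: qe1 + qj q *: qe2 + qk q *: qe3.
Proof. by apply: quatP => /=; ring. Qed.

Lemma quat_e1e1 : qe1 * qe1 = (- g1)%:A.
Proof. by apply: quatP => /=; ring. Qed.
Lemma quat_e2e2 : qe2 * qe2 = (- g2)%:A.
Proof. by apply: quatP => /=; ring. Qed.
Lemma quat_e3e3 : qe3 * qe3 = (- (g1 * g2))%:A.
Proof. by apply: quatP => /=; ring. Qed.
Lemma quat_e1e2 : qe1 * qe2 = qe3.
Proof. by apply: quatP => /=; ring. Qed.
Lemma quat_e2e1 : qe2 * qe1 = - qe3.
Proof. by apply: quatP => /=; ring. Qed.
Lemma quat_e2e3 : qe2 * qe3 = g2 *: qe1.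
Proof. by apply: quatP => /=; ring. Qed.
Lemma quat_e3e2 : qe3 * qe2 = - (g2 *: qe1).
Proof. by apply: quatP => /=; ring. Qed.
Lemma quat_e3e1 : qe3 * qe1 = g1 *: qe2.
Proof. by apply: quatP => /=; ring. Qed.
Lemma quat_e1e3 : qe1 * qe3 = - (g1 *: qe2).
Proof. by apply: quatP => /=; ring. Qed.

Definition qnorm q : R := Num.sqrt (qnorm2 q).

Definition sphere3 : set H := [set q | qnorm q = 1]%classic.
Definition sphere2 : set H := [set q | qre q = 0 /\ qnorm q = 1]%classic.

Lemma qnorm_eq1 q : qnorm q = 1 -> qnorm2 q = 1.
Proof.
move=> nq; have nq_ge0 : 0 <= qnorm2 q.
  by rewrite leNgt; apply/negP => nq_lt0; move/eqP: nq;
    rewrite /qnorm ler0_sqrtr ?ltW // eq_sym oner_eq0.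
by rewrite -(sqr_sqrtr nq_ge0) -/(qnorm q) nq expr1n.
Qed.

(* Membership of cos theta + eps sin theta in sphere3 is automatic, hence never
   needed as a separate hypothesis. *)
Lemma polar_sphere3 (theta : R) (eps : H) : eps \in sphere2 ->
  (cos theta)%:A + sin theta *: eps \in sphere3.
Proof.
rewrite inE => -[eps0 /qnorm_eq1]; rewrite inE /sphere3 /= /qnorm => neps.
suff -> : qnorm2 ((cos theta)%:A + sin theta *: eps) = 1 by rewrite sqrtr1.
rewrite -[RHS](cos2Dsin2 theta) -[X in _ = _ + X]mulr1 -neps.
by rewrite /qnorm2 /= eps0; ring.
Qed.

End QuatAlgebra.

Arguments sphere2 {R} g1 g2.
Arguments sphere3 {R} g1 g2.

(* Main.v *)
Require Import Defs.
From mathcomp Require Import all_boot all_order all_algebra.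
From mathcomp Require Import boolp classical_sets reals trigo.

Import GRing.Theory Num.Theory.
Local Open Scope ring_scope.

(** A pure quaternion [eps] of norm one is a square root of [-1]
    ([sphere2_sqr]), so the plane spanned by [1] and [eps] is a copy of the
    complex numbers in which [cos t + eps sin t] plays the role of the
    exponential of [eps t].  The addition formulas for cosine and sine say
    exactly that this exponential turns sums of angles into products
    ([cisD]); De Moivre's formula for all integers ([cisXz]) follows, the
    negative exponents because [cis eps (- t)] is a two-sided inverse of
    [cis eps t].  This takes place in any real algebra that contains a square
    root [eps] of [-1]; quaternions enter through [sphere2_sqr]. *)

Definition cis {R : realType} {A : unitAlgType R} (eps : A) (t : R) : A :=
  (cos t)%:A + sin t *: eps.

Lemma cis0 {R : realType} {A : unitAlgType R} (eps : A) : cis eps 0 = 1.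
Proof. by rewrite /cis cos0 sin0 scale1r scale0r addr0. Qed.

(** Expanding the product, [eps * eps = -1] puts the minus sign in front of
    [sin s * sin t], and the two components become the addition formulas. *)
Lemma cisD {R : realType} {A : unitAlgType R} (eps : A) (s t : R) :
  eps * eps = -1 -> cis eps (s + t) = cis eps s * cis eps t.
Proof.
move=> eps2; rewrite /cis cosD sinD mulrDl !mulrDr !mulr_algl !mulr_algr.
rewrite -scalerAl -scalerAr eps2 !scalerA !scalerN scalerBl scalerDl.
rewrite [cos t * sin s]mulrC -!addrA; congr (_ + _).
by rewrite addrC [X in X - _]addrC -addrA.
Qed.

Lemma cisXn {R : realType} {A : unitAlgType R} (eps : A) (t : R) (n : nat) :
  eps * eps = -1 -> cis eps t ^+ n = cis eps (n%:R * t).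
Proof.
move=> eps2; elim: n => [|n IHn]; first by rewrite mul0r cis0.
by rewrite exprS IHn -cisD // -[n.+1]add1n natrD mulrDl mul1r.
Qed.

Lemma cisV {R : realType} {A : unitAlgType R} (eps : A) (t : R) :
  eps * eps = -1 -> (cis eps t)^-1 = cis eps (- t).
Proof.
move=> eps2.
have cisNt : cis eps (- t) * cis eps t = 1 by rewrite -cisD // addNr cis0.
have cistN : cis eps t * cis eps (- t) = 1 by rewrite -cisD // addrN cis0.
have cis_unit : cis eps t \is a GRing.unit.
  by apply/unitrP; exists (cis eps (- t)).
by apply: (mulrI cis_unit); rewrite divrr.
Qed.

Lemma cisXz {R : realType} {A : unitAlgType R} (eps : A) (t : R) (n : int) :
  eps * eps = -1 -> cis eps t ^ n = cis eps (n%:~R * t).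
Proof.
move=> eps2; case: n => n; first exact: cisXn.
by rewrite NegzE -exprnN cisXn // cisV // mulrNz mulNr.
Qed.

(** A pure quaternion is opposite to its conjugate, so its square is the
    opposite of its squared norm. *)
Lemma sphere2_sqr (R : realType) (g1 g2 : R) (eps : quat g1 g2) :
  eps \in sphere2 g1 g2 -> eps * eps = -1.
Proof.
rewrite inE => -[eps0 /qnorm_eq1 neps].
have conj_eps : qconj eps = - eps by apply: quatP; rewrite //= eps0 oppr0.
by apply: oppr_inj; rewrite opprK -mulrN -conj_eps qmul_conj neps scale1r.
Qed.

Theorem theorem4p1 (R : realType) (g1 g2 : R) (hg1 : 0 < g1) (hg2 : 0 < g2)
    (theta : R) (eps : quat g1 g2) (heps : eps \in sphere2 g1 g2)
    (q : quat g1 g2) (hq : q = (cos theta)%:A + sin theta *: eps) (n : int) :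
  q ^ n = (cos (n%:~R * theta))%:A + sin (n%:~R * theta) *: eps.
Proof. by rewrite hq; apply: cisXz; exact: sphere2_sqr. Qed.
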